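(* Assume that on $H=\mathrm{co}\{x^1,\dots,x^N\}$: (i) $\Psi(x)\equiv\bar\Psi\in\mathbb R^{p\times m}$ is constant; (ii) $\delta(x)=\bar\delta_0+\bar\Delta x$ and $u_{\mathrm{des}}(x)=\bar u_0+\bar Ux$ are affine, with constant vectors and matrices $\bar\delta_0,\bar\Delta,\bar u_0,\bar U$ of appropriate dimensions; and (iii) $\mathcal U=\{u\in\mathbb R^m:Gu\le b\}$ with $G\in\mathbb R^{q\times m}$, $b\in\mathbb R^q$. Assume also vertex compatibility: for each $j=1,\dots,N$ there is $u^j\in\mathcal U$ with $\Psi(x^j)u^j+\delta(x^j)\ge 0$. Let $\mathcal R\subseteq H$ be a convex critical region. Then the safety-filter optimizer $u^\star(\cdot)$ is affine on $\mathcal R$; in particular, for any points $y^1,\dots,y^M\in\mathcal R$, any $\lambda\in\Delta_M$, and $x=\sum_{j=1}^M\lambda_jy^j\in\mathcal R$, $$u^\star(x)=\sum_{j=1}^M\lambda_j\,u^\star(y^j).$$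
   Context: Setting. Consider the control-affine system $\dot x=f(x)+g(x)u$ with $x\in\mathcal X\subseteq\mathbb R^n$, $u\in\mathcal U\subseteq\mathbb R^m$, where $f:\mathbb R^n\to\mathbb R^n$ and $g:\mathbb R^n\to\mathbb R^{n\times m}$ are locally Lipschitz and $\mathcal U$ is nonempty, compact and convex. Let $h_1,\dots,h_p:\mathcal X\to\mathbb R$ be $C^1$ and let $\alpha_1,\dots,\alpha_p$ be extended class-$\mathcal K_\infty$ functions (continuous, strictly increasing bijections $\mathbb R\to\mathbb R$ with $\alpha_i(0)=0$). With $\nabla h_i(x)$ the gradient as a row vector, put $L_fh_i(x)=\nabla h_i(x)f(x)$ and $L_gh_i(x)=\nabla h_i(x)g(x)\in\mathbb R^{1\times m}$. Let $\Psi(x)\in\mathbb R^{p\times m}$ have $i$th row $\Psi_i(x)=L_gh_i(x)$, and let $\delta(x)\in\mathbb R^p$ have entries $\delta_i(x)=L_fh_i(x)+\alpha_i(h_i(x))$. Points $x^1,\dots,x^N\in\mathcal X$ are given with $H=\mathrm{co}\{x^1,\dots,x^N\}\subseteq\mathcal X$. Vector inequalities are componentwise, and $\Delta_M=\{\lambda\in\mathbb R^M:\lambda_j\ge 0,\ \sum_j\lambda_j=1\}$. Safety filter. Given a desired input $u_{\mathrm{des}}(x)\in\mathbb R^m$, $u^\star(x)$ is the (unique, when the problem is feasible) minimizer of $\tfrac12\|u-u_{\mathrm{des}}(x)\|^2$ over $u\in\mathcal U$ subject to $\Psi(x)u+\delta(x)\ge 0$. Critical region. Let $\mathcal A(x)=\{i\in\{1,\dots,p\}:\Psi_i(x)u^\star(x)+\delta_i(x)=0\}$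 and $\mathcal B(x)=\{\ell\in\{1,\dots,q\}:G_\ell u^\star(x)=b_\ell\}$ be the sets of active constraints at the optimum; $\Psi_{\mathcal A}(x)$ and $G_{\mathcal B}$ denote the submatrices of active rows. A critical region is a set of states on which (i) the active sets $(\mathcal A(x),\mathcal B(x))$ are constant; (ii) LICQ holds: the rows of $\begin{bmatrix}\Psi_{\mathcal A}(x)\\ G_{\mathcal B}\end{bmatrix}$ are linearly independent; and (iii) strict complementarity holds: all Karush–Kuhn–Tucker multipliers of active constraints are positive, i.e. the multipliers $\lambda_{\mathcal A},\nu_{\mathcal B}$ with $u^\star(x)-u_{\mathrm{des}}(x)-\Psi_{\mathcal A}(x)^\top\lambda_{\mathcal A}+G_{\mathcal B}^\top\nu_{\mathcal B}=0$ have all entries $>0$. *)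

(* Defs.v *)
From mathcomp Require Export all_boot all_order all_algebra.
From mathcomp Require Export all_classical all_reals all_analysis.
Export numFieldNormedType.Exports.
Set Implicit Arguments.
Unset Strict Implicit.
Unset Printing Implicit Defensive.
Import Order.TTheory GRing.Theory Num.Theory.
Local Open Scope classical_set_scope.
Local Open Scope ring_scope.

Definition vle (R : realType) (k : nat) (v w : 'cV[R]_k) : Prop :=
  forall i, v i 0 <= w i 0.

(* The norm `|v| that the library puts on matrices is the sup norm, whereas the
   cost of the safety filter uses the Euclidean one. *)
Definition enorm (R : realType) (k : nat) (v : 'cV[R]_k) : R :=
  Num.sqrt (\sum_i v i 0 ^+ 2).

Definition simplex (R : realType) (M : nat) : set 'cV[R]_M :=
  [set lam | (forall j, 0 <= lam j 0) /\ \sum_j lam j 0 = 1].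

Definition conv_hull (R : realType) (n N : nat) (xs : 'I_N -> 'cV[R]_n) :
    set 'cV[R]_n :=
  [set x | exists2 lam, @simplex R N lam & x = \sum_j lam j 0 *: xs j].

Definition gradient (R : realType) (n : nat) (h : 'cV[R]_n -> R)
    (x : 'cV[R]_n) : 'rV[R]_n :=
  \row_j 'D_(delta_mx j 0) h x.

(* X need not be open: as usual, C^1 on X means C^1 on an open neighbourhood
   of X. *)
Definition C1_on (R : realType) (n : nat) (X : set 'cV[R]_n)
    (h : 'cV[R]_n -> R) : Prop :=
  exists O : set 'cV[R]_n,
    [/\ open O, X `<=` O, (forall x, O x -> differentiable h x)
      & {within O, continuous (gradient h)}].

Definition ext_class_Kinfty (R : realType) (alpha : R -> R) : Prop :=
  [/\ continuous alpha, {homo alpha : s t / s < t}, bijective alpha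
    & alpha 0 = 0].

(* With k = 1 this is the 1 x 1 matrix of L_f h(x), with k = m the row vector
   L_g h(x). *)
Definition lie (R : realType) (n k : nat) (F : 'cV[R]_n -> 'M[R]_(n, k))
    (h : 'cV[R]_n -> R) (x : 'cV[R]_n) : 'rV[R]_k :=
  gradient h x *m F x.

Definition Psi (R : realType) (n m p : nat) (g : 'cV[R]_n -> 'M[R]_(n, m))
    (h : 'I_p -> 'cV[R]_n -> R) (x : 'cV[R]_n) : 'M[R]_(p, m) :=
  \matrix_(i < p) lie g (h i) x.

Definition delta (R : realType) (n p : nat) (f : 'cV[R]_n -> 'cV[R]_n)
    (h : 'I_p -> 'cV[R]_n -> R) (alpha : 'I_p -> R -> R) (x : 'cV[R]_n) :
    'cV[R]_p :=
  \col_i (lie f (h i) x 0 0 + alpha i (h i x)).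

Section SafetyFilter.
Context {R : realType} {n m p q : nat}.
Variables (P : 'cV[R]_n -> 'M[R]_(p, m)) (d : 'cV[R]_n -> 'cV[R]_p).
Variable udes : 'cV[R]_n -> 'cV[R]_m.

Definition admissible (U : set 'cV[R]_m) (x : 'cV[R]_n) : set 'cV[R]_m :=
  [set u | U u /\ vle 0 (P x *m u + d x)].

Definition filter_cost (x : 'cV[R]_n) (u : 'cV[R]_m) : R :=
  2^-1 * enorm (u - udes x) ^+ 2.

(* The values of ustar where the program is infeasible are left arbitrary. *)
Definition is_safety_filter (X : set 'cV[R]_n) (U : set 'cV[R]_m)
    (ustar : 'cV[R]_n -> 'cV[R]_m) : Prop :=
  forall x, X x -> admissible U x !=set0 ->
    admissible U x (ustar x) /\
    forall u, admissible U x u -> filter_cost x (ustar x) <= filter_cost x u.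

Variables (G : 'M[R]_(q, m)) (b : 'cV[R]_q).
Variable ustar : 'cV[R]_n -> 'cV[R]_m.

Definition active_safety (x : 'cV[R]_n) : {set 'I_p} :=
  [set i | (P x *m ustar x + d x) i 0 == 0]%SET.

Definition active_input (x : 'cV[R]_n) : {set 'I_q} :=
  [set l | (G *m ustar x) l 0 == b l 0]%SET.

Definition subrows (k : nat) (I : {set 'I_k}) (M : 'M[R]_(k, m)) :
    'M[R]_(#|I|, m) :=
  rowsub (fun i : 'I_#|I| => enum_val i) M.

Definition LICQ (x : 'cV[R]_n) : Prop :=
  row_free (col_mx (subrows (active_safety x) (P x))
                   (subrows (active_input x) G)).

(* When U = {u | G u <= b}, ustar x is the minimizer and LICQ holds at x, there
   is exactly one pair (lam, nu) satisfying the stationarity equation. *)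
Definition strict_complementarity (x : 'cV[R]_n) : Prop :=
  forall (lam : 'cV[R]_#|active_safety x|) (nu : 'cV[R]_#|active_input x|),
    ustar x - udes x - (subrows (active_safety x) (P x))^T *m lam
      + (subrows (active_input x) G)^T *m nu = 0 ->
    (forall i, 0 < lam i 0) /\ (forall l, 0 < nu l 0).

Definition critical_region (S : set 'cV[R]_n) : Prop :=
  [/\ forall x y, S x -> S y ->
        active_safety x = active_safety y /\ active_input x = active_input y,
      forall x, S x -> LICQ x
    & forall x, S x -> strict_complementarity x].

End SafetyFilter.

(* Main.v *)
Require Import Defs.
From mathcomp Require Import ring.
Set Implicit Arguments.
Unset Strict Implicit.
Unset Printing Implicit Defensive.
Import Order.TTheory GRing.Theory Num.Theory.
Local Open Scope classical_set_scope.
Local Open Scope ring_scope.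

(* If A v = 0 for the matrix A of active rows, then u*(x) + t v stays admissible
   for small t of either sign, because the inactive constraints are slack. Hence
   u*(x) - udes(x) is orthogonal to ker A, so it is A^T mu for some mu, of
   whatever sign. On a critical region A is constant and A u*(x) = c(x) is affine
   in x; LICQ makes A A^T invertible, so
     u*(x) = udes(x) + A^T (A A^T)^-1 (c(x) - A udes(x)),
   which is affine in x. *)

(** * Convex combinations *)

Section Convexity.
Variable R : realType.

Lemma vle_conv_comb (k M : nat) (lam : 'cV[R]_M) (v w : 'I_M -> 'cV[R]_k) :
  (forall j, 0 <= lam j 0) -> (forall j, vle (v j) (w j)) ->
  vle (\sum_j lam j 0 *: v j) (\sum_j lam j 0 *: w j).
Proof.
move=> lam0 vw i; rewrite !summxE; apply: ler_sum => j _.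
by rewrite !mxE; exact: ler_wpM2l (lam0 j) _ _ (vw j i).
Qed.

Lemma affine_conv_comb (n k M : nat) (lam : 'cV[R]_M) (A : 'M[R]_(k, n))
    (a : 'cV[R]_k) (x : 'I_M -> 'cV[R]_n) :
  \sum_j lam j 0 = 1 ->
  A *m (\sum_j lam j 0 *: x j) + a = \sum_j lam j 0 *: (A *m x j + a).
Proof.
move=> lam1; under [RHS]eq_bigr do rewrite scalerDr.
rewrite big_split -scaler_suml lam1 scale1r mulmx_sumr.
by under [in LHS]eq_bigr do rewrite -scalemxAr.
Qed.

Lemma sub_conv_hull (n N : nat) (xs : 'I_N -> 'cV[R]_n) (j : 'I_N) :
  conv_hull xs (xs j).
Proof.
exists (delta_mx j 0).
  split=> [i|]; first by rewrite mxE ler0n.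
  rewrite (bigD1 j) //= mxE !eqxx big1 ?addr0 // => i /negPf ij.
  by rewrite mxE ij.
rewrite (bigD1 j) //= mxE !eqxx scale1r big1 ?addr0 // => i /negPf ij.
by rewrite mxE ij scale0r.
Qed.

(** Two-point convexity extends to [M] points by induction: split off the first point and divide the
    remaining weights by [1 - l ord0]. The case [l ord0 = 1], where this quotient is meaningless, is
    separate: all other weights vanish. *)
Lemma convex_set_sum (E : lmodType R) (A : set E) (M : nat)
    (l : 'I_M -> R) (y : 'I_M -> E) :
  convex_set (A : set (convex_lmodType E)) ->
  (forall j, A (y j)) -> (forall j, 0 <= l j) -> \sum_j l j = 1 ->
  A (\sum_j l j *: y j).
Proof.
move=> Aconv; elim: M l y => [|M IH] l y Ay l0.
  (* With no points the weights sum to 0, not to 1, so the base case is vacuous. *)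
  by rewrite big_ord0 => /esym/eqP; rewrite oner_eq0.
rewrite !big_ord_recl => lsum.
have tail0 : 0 <= \sum_(i < M) l (lift ord0 i) by apply: sumr_ge0.
have [l1|l1] := eqVneq (l ord0) 1.
  have /psumr_eq0P tail : \sum_(i < M) l (lift ord0 i) = 0.
    by apply: (addrI (l ord0)); rewrite lsum addr0.
  rewrite l1 scale1r big1 ?addr0 // => i _.
  by rewrite tail ?scale0r.
have t_gt0 : 0 < 1 - l ord0.
  by rewrite lt_neqAle eq_sym subr_eq0 eq_sym l1 -lsum addrC addKr.
have tailE : \sum_(i < M) l (lift ord0 i) = 1 - l ord0.
  by rewrite -lsum addrC addKr.
have Atail :
    A (\sum_(i < M) (l (lift ord0 i) / (1 - l ord0)) *: y (lift ord0 i)).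
  apply: IH => [j|j|]; first exact: Ay.
    by rewrite divr_ge0 // ltW.
  by rewrite -mulr_suml tailE divff // gt_eqF.
have l0_le1 : l ord0 <= 1 by rewrite -subr_ge0 ltW.
(* [convex_set] quantifies over bundled elements of [0, 1], so the first weight is packaged as
   one. *)
have l0_01 : Itv.spec (@Itv.num_sem R) (Itv.Real `[0%Z, 1%Z]) (l ord0).
  by rewrite /Itv.num_sem /= num_real in_itv /= l0 l0_le1.
have := Aconv (y ord0) _ (Itv.mk l0_01) (mem_set (Ay ord0)) (mem_set Atail).
move/set_mem; congr (A _); congr (_ + _).
rewrite scaler_sumr; apply: eq_bigr => i _.
by rewrite scalerA mulrC divfK // gt_eqF.
Qed.

End Convexity.

(** * First-order optimality for projection onto a polyhedron *)

Section FirstOrder.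
Variable R : realType.

Lemma enorm_sqr (k : nat) (v : 'cV[R]_k) : enorm v ^+ 2 = (v^T *m v) 0 0.
Proof.
rewrite sqr_sqrtr; last by apply: sumr_ge0 => i _; exact: sqr_ge0.
by rewrite mxE; apply: eq_bigr => i _; rewrite mxE expr2.
Qed.

Lemma dot_eq0 (k : nat) (v : 'cV[R]_k) : (v^T *m v) 0 0 = 0 -> v = 0.
Proof.
rewrite mxE => /psumr_eq0P v0; apply/matrixP => i j.
rewrite ord1 mxE; apply/eqP; rewrite -sqrf_eq0 expr2; apply/eqP.
have := v0 _ i isT; rewrite mxE; apply=> {}i _.
by rewrite mxE -expr2 sqr_ge0.
Qed.

(** If z A A^T = 0 then the squared norm of (z A)^T is z A A^T z^T = 0, so z A = 0, and row freeness
    gives z = 0. *)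
Lemma row_free_gram (k m : nat) (A : 'M[R]_(k, m)) :
  row_free A -> A *m A^T \in unitmx.
Proof.
move=> Afree; rewrite -row_free_unit -kermx_eq0.
apply/rowV0P => z /sub_kermxP zAA.
apply: (row_free_inj Afree); rewrite mul0mx.
apply: trmx_inj; rewrite trmx0; apply: dot_eq0.
by rewrite trmxK trmx_mul mulmxA -(mulmxA z) zAA mul0mx mxE.
Qed.

(** A tight row keeps its value along [v]; a slack row stays slack for small [t] by continuity.
    There are finitely many rows, so the neighbourhoods intersect in one. *)
Lemma near_polyhedron (k m : nat) (A : 'M[R]_(k, m)) (c : 'cV[R]_k)
    (u v : 'cV[R]_m) :
  vle (A *m u) c ->
  (forall i, (A *m u) i 0 = c i 0 -> (A *m v) i 0 = 0) ->
  \forall t \near (0 : R), vle (A *m (u + t *: v)) c.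
Proof.
move=> uc vact.
suff near_row i : \forall t \near (0 : R), (A *m (u + t *: v)) i 0 <= c i 0.
  exact: (filter_forall (nbhs_filter (0 : R)) near_row).
have E t : (A *m (u + t *: v)) i 0 = (A *m u) i 0 + t * (A *m v) i 0.
  by rewrite mulmxDr -scalemxAr mxE [X in _ + X]mxE.
have [uci|uci] := eqVneq ((A *m u) i 0) (c i 0).
  by near=> t; rewrite E (vact i uci) mulr0 addr0 uci.
suff : \forall t \near (0 : R), (A *m u) i 0 + t * (A *m v) i 0 <= c i 0.
  by apply: filterS => t; rewrite E.
have lim : (A *m u) i 0 + t * (A *m v) i 0 @[t --> (0 : R)] --> (A *m u) i 0.
  rewrite -[X in _ --> X]addr0 -[X in _ + X](mul0r ((A *m v) i 0)).
  by apply: cvgD; [exact: cvg_cst|apply: cvgMr_tmp; exact: cvg_id].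
by apply: cvgr_le lim _ _; rewrite lt_neqAle uci uc.
Unshelve. all: by end_near. Qed.

(** If a were nonzero, moving against its sign would make the linear term win: at t = - a s the
    expression is a^2 s (c s - 1), negative for small s > 0. *)
Lemma near_quadratic_linear0 (a c : R) :
  (\forall t \near (0 : R), 0 <= a * t + c * t ^+ 2) -> a = 0.
Proof.
move=> near_ge0; apply/eqP/negPn/negP => a_neq0.
have scale_cvg (b : R) : b * s @[s --> (0 : R)] --> (0 : R).
  by rewrite -[X in _ --> X](mulr0 b); apply: cvgMl_tmp; exact: cvg_id.
have near1 : \forall s \near (0 : R), 0 <= a * (- a * s) + c * (- a * s) ^+ 2.
  exact: scale_cvg near_ge0.
have near2 : \forall s \near (0 : R), c * s < 1.
  exact: (cvgr_lt _ (scale_cvg c)).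
near (0 : R)^'+ => s.
have s0 : 0 < s by near: s; exact: nbhs_right_gt.
have : 0 <= a * (- a * s) + c * (- a * s) ^+ 2.
  by near: s; exact: cvg_within near1.
have cs1 : c * s < 1 by near: s; exact: cvg_within near2.
have -> : a * (- a * s) + c * (- a * s) ^+ 2 = a ^+ 2 * s * (c * s - 1).
  by ring.
rewrite pmulr_rge0 ?subr_ge0 ?leNgt ?cs1 //.
by rewrite mulr_gt0 // exprn_even_gt0.
Unshelve. all: by end_near. Qed.

(** With z = u - w, the increase of the squared norm is 2 t z^T v + t^2 v^T v. It is nonnegative for
    small [t] of both signs, so its linear coefficient vanishes. *)
Lemma minimizer_orthogonal (m : nat) (u w v : 'cV[R]_m) :
  (\forall t \near (0 : R),
     enorm (u - w) ^+ 2 <= enorm (u + t *: v - w) ^+ 2) ->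
  ((u - w)^T *m v) 0 0 = 0.
Proof.
move=> umin; suff /eqP : ((u - w)^T *m v) 0 0 *+ 2 = 0.
  by rewrite mulrn_eq0 => /eqP.
apply: (@near_quadratic_linear0 _ ((v^T *m v) 0 0)).
apply: filterS umin => t; rewrite !enorm_sqr -subr_ge0 addrAC.
move: (u - w) => z; congr (0 <= _).
have vz : (v^T *m z) 0 0 = (z^T *m v) 0 0.
  have -> : v^T *m z = (z^T *m v)^T by rewrite trmx_mul trmxK.
  by rewrite [LHS]mxE.
have -> : (z + t *: v)^T = z^T + t *: v^T by rewrite linearD linearZ.
rewrite mulmxDl !mulmxDr -!scalemxAl -!scalemxAr.
move: vz; move: (v^T *m z) (z^T *m v) (v^T *m v) (z^T *m z) => p q r s pq.
by rewrite !mxE pq; ring.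
Qed.

(** The columns of [cokermx A] lie in the kernel of [A], so [w^T] annihilates them, which is the
    criterion [submxE] for [w^T] to lie in the row space of [A]. *)
Lemma row_space_orthogonal (k m : nat) (A : 'M[R]_(k, m)) (w : 'cV[R]_m) :
  (forall v : 'cV[R]_m, A *m v = 0 -> (w^T *m v) 0 0 = 0) ->
  exists mu, w = A^T *m mu.
Proof.
move=> wA; have /submxP [D wE] : (w^T <= A)%MS.
  rewrite submxE; apply/eqP; move: (mulmx_coker A).
  move: (cokermx A) => B AB0; apply/matrixP => i j; rewrite ord1 [RHS]mxE.
  have := wA (col j B); rewrite colE !mulmxA AB0 mul0mx -colE => /(_ erefl).
  by rewrite mxE.
by exists D^T; rewrite -trmx_mul -wE trmxK.
Qed.

(** Multiplying u - w = A^T mu by A gives A A^T mu = c - A w, which determines mu because the Gram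
    matrix is invertible. *)
Lemma projection_formula (k m : nat) (A : 'M[R]_(k, m)) (c mu : 'cV[R]_k)
    (u w : 'cV[R]_m) :
  row_free A -> A *m u = c -> u - w = A^T *m mu ->
  u = w + A^T *m (invmx (A *m A^T) *m (c - A *m w)).
Proof.
move=> /row_free_gram AAunit Au uw.
suff -> : invmx (A *m A^T) *m (c - A *m w) = mu by rewrite -uw addrC subrK.
by rewrite -Au -mulmxBr uw (mulmxA A) mulKmx.
Qed.

(** This is the stationarity equation, with multipliers of unspecified sign. [I] and [J] have to
    contain the active indices, so that every row outside them is slack. *)
Lemma minimizer_active_rows (p q m : nat) (P : 'M[R]_(p, m)) (d : 'cV[R]_p)
    (G : 'M[R]_(q, m)) (b : 'cV[R]_q) (u w : 'cV[R]_m)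
    (I : {set 'I_p}) (J : {set 'I_q}) :
  vle 0 (P *m u + d) -> vle (G *m u) b ->
  (forall v, vle 0 (P *m v + d) -> vle (G *m v) b ->
     enorm (u - w) ^+ 2 <= enorm (v - w) ^+ 2) ->
  (forall i, (P *m u + d) i 0 = 0 -> i \in I) ->
  (forall l, (G *m u) l 0 = b l 0 -> l \in J) ->
  exists mu, u - w = (col_mx (subrows I P) (subrows J G))^T *m mu.
Proof.
move=> Pu Gu umin actI actJ; apply: row_space_orthogonal => v.
rewrite mul_col_mx -col_mx0 => /eq_col_mx [Pv0 Gv0].
have Pv i : i \in I -> (P *m v) i 0 = 0.
  move=> iI; move/matrixP/(_ (enum_rank_in iI i) 0): Pv0.
  by rewrite mul_rowsub_mx mxE enum_rankK_in // => ->; rewrite mxE.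
have Gv l : l \in J -> (G *m v) l 0 = 0.
  move=> lJ; move/matrixP/(_ (enum_rank_in lJ l) 0): Gv0.
  by rewrite mul_rowsub_mx mxE enum_rankK_in // => ->; rewrite mxE.
(* The safety constraint is put in the form [- P *m z <= d], so that [near_polyhedron] serves both
   families of constraints. *)
have vleP z : vle 0 (P *m z + d) <-> vle (- P *m z) d.
  have E i : (0 <= (P *m z + d) i 0) = ((- P *m z) i 0 <= d i 0).
    by rewrite mulNmx [(P *m z + d) i 0]mxE
      [(- (P *m z)) i 0]mxE -lerBlDl sub0r.
  by split=> H i; have := H i; rewrite [(0 : 'cV[R]_p) i 0]mxE E.
have nearP : \forall t \near (0 : R), vle (- P *m (u + t *: v)) d.
  apply: near_polyhedron; first exact/vleP.
  move=> i; rewrite !mulNmx mxE [X in _ -> X = _]mxE => Pui.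
  rewrite Pv ?oppr0 //; apply: actI.
  by rewrite mxE -Pui subrr.
have nearG : \forall t \near (0 : R), vle (G *m (u + t *: v)) b.
  by apply: near_polyhedron => // l /actJ /Gv.
apply: minimizer_orthogonal; near=> t; apply: umin.
  by apply/vleP; near: t.
by near: t.
Unshelve. all: by end_near. Qed.

End FirstOrder.

(** * Feasibility on the hull and the affine law on the critical region *)

Theorem theorem4 (R : realType) (n m p q N : nat)
  (X : set 'cV[R]_n) (U : set 'cV[R]_m)
  (f : 'cV[R]_n -> 'cV[R]_n) (g : 'cV[R]_n -> 'M[R]_(n, m))
  (h : 'I_p -> 'cV[R]_n -> R) (alpha : 'I_p -> R -> R)
  (udes ustar : 'cV[R]_n -> 'cV[R]_m)
  (xs : 'I_N -> 'cV[R]_n)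
  (Psibar : 'M[R]_(p, m))
  (delta0 : 'cV[R]_p) (Deltabar : 'M[R]_(p, n))
  (u0 : 'cV[R]_m) (Ubar : 'M[R]_(m, n))
  (G : 'M[R]_(q, m)) (b : 'cV[R]_q)
  (CR : set 'cV[R]_n)
  (f_lip : [locally [lipschitz f x | x in [set: 'cV[R]_n]]])
  (g_lip : [locally [lipschitz g x | x in [set: 'cV[R]_n]]])
  (U_nonempty : U !=set0) (U_compact : compact U)
  (U_convex : convex_set (U : set (convex_lmodType 'cV[R]_m)))
  (h_C1 : forall i, C1_on X (h i))
  (alpha_K : forall i, ext_class_Kinfty (alpha i))
  (xs_X : forall j, X (xs j))
  (hull_X : conv_hull xs `<=` X)
  (ustar_filter :
     is_safety_filter (Psi g h) (delta f h alpha) udes X U ustar)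
  (Psi_const : forall x, conv_hull xs x -> Psi g h x = Psibar)
  (delta_affine : forall x, conv_hull xs x ->
     delta f h alpha x = delta0 + Deltabar *m x)
  (udes_affine : forall x, conv_hull xs x -> udes x = u0 + Ubar *m x)
  (U_polyhedral : U = [set u | vle (G *m u) b])
  (vertex_compat : forall j, exists2 u, U u &
     vle 0 (Psi g h (xs j) *m u + delta f h alpha (xs j)))
  (CR_hull : CR `<=` conv_hull xs)
  (CR_convex : convex_set (CR : set (convex_lmodType 'cV[R]_n)))
  (CR_critical :
     critical_region (Psi g h) (delta f h alpha) udes G b ustar CR) :
  (exists (K : 'M[R]_(m, n)) (k : 'cV[R]_m),
     forall x, CR x -> ustar x = K *m x + k) /\
  (forall (M : nat) (y : 'I_M -> 'cV[R]_n) (lam : 'cV[R]_M),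
     (forall j, CR (y j)) -> @simplex R M lam ->
     CR (\sum_j lam j 0 *: y j) /\
     ustar (\sum_j lam j 0 *: y j) = \sum_j lam j 0 *: ustar (y j)).
Proof.
(* [ustar] is constrained only where the program is feasible. Combining the vertex inputs with the
   weights of [x] gives an admissible input, since the safety constraint is jointly affine in state
   and input when [Psi] is constant. *)
have feasible x : conv_hull xs x ->
    admissible (Psi g h) (delta f h alpha) U x !=set0.
  move=> hx; case: (hx) => lam [lam0 lam1] xE.
  have /boolp.choice [v vU] : forall j, exists u,
      U u /\ vle 0 (Psi g h (xs j) *m u + delta f h alpha (xs j)).
    by move=> j; have [u Uu uj] := vertex_compat j; exists u.
  exists (\sum_j lam j 0 *: v j); split.
    by apply: convex_set_sum => // j; exact: (vU j).1.
  have -> : Psi g h x *m (\sum_j lam j 0 *: v j) + delta f h alpha x =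
      \sum_j lam j 0 *: (Psi g h (xs j) *m v j + delta f h alpha (xs j)).
    rewrite (Psi_const _ hx) (delta_affine _ hx) [delta0 + _]addrC xE.
    (* The inserted zero offset lets [affine_conv_comb] handle the linear term in the input as
       well. *)
    rewrite (affine_conv_comb Deltabar delta0 xs lam1) -[X in X + _]addr0.
    rewrite (affine_conv_comb Psibar 0 v lam1) -big_split.
    apply: eq_bigr => j _ /=.
    rewrite (Psi_const _ (sub_conv_hull _ _)).
    rewrite (delta_affine _ (sub_conv_hull _ _)).
    by rewrite -scalerDr addr0 [delta0 + _]addrC.
  have := vle_conv_comb lam0 (fun j => (vU j).2).
  by rewrite [X in vle X _]big1 // => j _; rewrite scaler0.
have affine : exists (K : 'M[R]_(m, n)) (k : 'cV[R]_m),
    forall x, CR x -> ustar x = K *m x + k.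
  have [[x0 CRx0]|CR0] := pselect (CR !=set0); last first.
    by exists 0, 0 => x CRx; case: CR0; exists x.
  case: CR_critical => same_active licq _.
  (* The active sets are read off at the reference point [x0], so that [A], [c0] and [C] do not
     depend on [x]. The active equations become [A *m ustar x = c0 + C *m x]; the lower block of [C]
     is zero because [b] is constant. *)
  set I := active_safety (Psi g h) (delta f h alpha) ustar x0.
  set J := active_input G b ustar x0.
  pose A := col_mx (subrows I Psibar) (subrows J G).
  pose c0 := col_mx (- subrows I delta0) (subrows J b).
  pose C := col_mx (- subrows I Deltabar) (0 : 'M[R]_(#|J|, n)).
  pose B := A^T *m invmx (A *m A^T).
  (* The linear and constant parts in x of udes(x) + B (c0 + C x - A udes(x)), where udes(x) = u0 +
     Ubar x. *)
  exists (Ubar + B *m (C - A *m Ubar)), (u0 + B *m (c0 - A *m u0)) => x CRx.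
  have hx := CR_hull _ CRx.
  have [IE JE] := same_active _ _ CRx CRx0.
  have [[Uu Pu] umin] := ustar_filter _ (hull_X _ hx) (feasible x hx).
  rewrite U_polyhedral /= in Uu.
  have memI i :
      (i \in I) = ((Psi g h x *m ustar x + delta f h alpha x) i 0 == 0).
    by rewrite /I -IE inE.
  have memJ l : (l \in J) = ((G *m ustar x) l 0 == b l 0).
    by rewrite /J -JE inE.
  have A_free : row_free A.
    by have := licq _ CRx0; rewrite /LICQ (Psi_const _ (CR_hull _ CRx0)).
  have Au : A *m ustar x = c0 + C *m x.
    rewrite !mul_col_mx add_col_mx mul0mx addr0; congr col_mx.
      apply/matrixP => i j; rewrite ord1 mulNmx -opprD !mul_rowsub_mx.
      have := enum_valP i; rewrite memI => /eqP.
      rewrite (Psi_const _ hx) (delta_affine _ hx) mxE [X in _ + X]mxE => Pi.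
      rewrite mxE [RHS]mxE [X in - X]mxE [X in - (X + _)]mxE.
      rewrite [X in - (_ + X)]mxE.
      by apply/eqP; rewrite -addr_eq0; apply/eqP.
    apply/matrixP => l j; rewrite ord1 mul_rowsub_mx.
    by have := enum_valP l; rewrite memJ => /eqP Gl; rewrite [LHS]mxE [RHS]mxE.
  have [mu muE] : exists mu, ustar x - udes x = A^T *m mu.
    rewrite /A -(Psi_const _ hx).
    apply: (minimizer_active_rows Pu Uu) => [v Pv Gv|i Pi|l Gl].
    - have := umin v; rewrite /filter_cost ler_pM2l ?invr_gt0 //; apply.
      by split; rewrite // U_polyhedral.
    - by rewrite memI; apply/eqP.
    - by rewrite memJ; apply/eqP.
  rewrite (projection_formula A_free Au muE) (udes_affine _ hx) mulmxA -/B.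
  have -> : c0 + C *m x - A *m (u0 + Ubar *m x) =
      (c0 - A *m u0) + (C - A *m Ubar) *m x.
    by rewrite mulmxDr mulmxBl (mulmxA A) opprD addrACA.
  by rewrite [B *m (_ + _)]mulmxDr addrACA [RHS]addrC
    [(Ubar + _) *m _]mulmxDl -(mulmxA B).
split=> // M y lam yCR [lam0 lam1].
split; first exact: convex_set_sum.
have CRsum : CR (\sum_j lam j 0 *: y j) by apply: convex_set_sum.
have [K [k uE]] := affine.
rewrite uE // (affine_conv_comb _ _ _ lam1).
by apply: eq_bigr => j _; rewrite uE.
Qed.
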